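(* If $X$ is a reflexive Banach space, then every weakly demi Dunford-Pettis operator $T\colon X\to X$ is a demi Dunford-Pettis operator.
   Context: Operators are bounded and linear. $X'$ and $X''$ denote the topological dual and bidual of $X$; weak convergence in $X$ is convergence in $\sigma(X,X')$ and weak convergence in $X'$ is convergence in $\sigma(X',X'')$. An operator $T\colon X\to X$ is demi Dunford-Pettis if for every sequence $(x_j)_{j=1}^{\infty}$ in $X$ with $x_j\to 0$ weakly and $\|x_j-T(x_j)\|\to 0$, one has $\|x_j\|\to 0$. An operator $T\colon X\to X$ is weakly demi Dunford-Pettis if for all sequences $(x_j)_{j=1}^{\infty}$ in $X$ and $(f_j)_{j=1}^{\infty}$ in $X'$ with $x_j\to 0$ weakly in $X$, $f_j\to 0$ weakly in $X'$ and $\|x_j-T(x_j)\|\to 0$, one has $|f_j(x_j)|\to 0$ as $j\to\infty$. *)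

(* Defs.v *)
From HB Require Import structures.
From mathcomp Require Import all_boot all_order all_algebra.
From mathcomp Require Import complex.
From mathcomp Require Import all_classical all_reals all_analysis.

Set Implicit Arguments.
Unset Strict Implicit.
Unset Printing Implicit Defensive.

Import Order.TTheory GRing.Theory Num.Theory.
Import numFieldNormedType.Exports.

Local Open Scope classical_set_scope.
Local Open Scope ring_scope.

(* MathComp norms take their values in the scalar field, so the operator norm
   of a functional is a supremum of nonnegative elements of K.  The structure
   below is the common interface through which the dual of a normed space is
   defined at once over the reals and over the complex numbers. *)
HB.mixin Record NumField_hasNonnegSup K & Num.NumField K := {
  nonneg_sup_ex : forall A : set K, A !=set0 -> A `<=` [set x | 0 <= x] ->
    ubound A !=set0 -> supremums A !=set0
}.

#[short(type="supNumFieldType")]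
HB.structure Definition SupNumField :=
  {K of NumField_hasNonnegSup K & Num.NumField K}.

Section real_sup.
Variable R : realType.

Let nonneg_sup_ex_real (A : set R) : A !=set0 -> A `<=` [set x | 0 <= x] ->
  ubound A !=set0 -> supremums A !=set0.
Proof.
move=> A0 _ ubA; have hsA : has_sup A by split.
exists (sup A); split; first exact: sup_upper_bound.
by move=> y yA; apply: ge_sup.
Qed.

#[non_forgetful_inheritance]
HB.instance Definition _ := NumField_hasNonnegSup.Build R nonneg_sup_ex_real.

Let nonneg_sup_ex_complex (A : set R[i]) : A !=set0 ->
  A `<=` [set x | 0 <= x] -> ubound A !=set0 -> supremums A !=set0.
Proof.
move=> [a Aa] A_ge0 [M ubM].
have AE x : A x -> x = (complex.Re x)%:C%C.
  by move=> /A_ge0/=; case: x => x y; rewrite lecE/= => /andP[/eqP -> _].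
have ubE z : ubound A z -> 0 <= z.
  by move=> /(_ _ Aa); apply: le_trans; exact: A_ge0.
have hsA : has_sup [set complex.Re x | x in A].
  split; first by exists (complex.Re a), a.
  exists (complex.Re M) => _ [x Ax <-].
  by have := ubM _ Ax; rewrite lecE => /andP[].
exists ((sup [set complex.Re x | x in A])%:C%C); split.
  move=> x Ax; rewrite (AE _ Ax) lecR; apply: sup_upper_bound => //.
  by exists x.
move=> z zA; have := ubE _ zA; rewrite !lecE/= => /andP[/eqP Imz _].
rewrite Imz eqxx/=; apply: ge_sup; first by case: hsA.
by move=> _ [x Ax <-]; have := zA _ Ax; rewrite lecE => /andP[].
Qed.

HB.instance Definition _ :=
  NumField_hasNonnegSup.Build R[i] nonneg_sup_ex_complex.

End real_sup.

Definition cont_linear (K : supNumFieldType) (X : normedModType K) :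
    {pred X -> K^o} :=
  mem [set f : X -> K^o | linear f /\ continuous f].

Record dual (K : supNumFieldType) (X : normedModType K) := Dual {
  dual_val :> X -> K^o;
  dualP : dual_val \in @cont_linear K X
}.

Section dual_lmodule.
Context {K : supNumFieldType} {X : normedModType K}.

HB.instance Definition _ := [isSub for @dual_val K X].
HB.instance Definition _ := [Choice of dual X by <:].

Lemma cont_linear_submod_closed : submod_closed (@cont_linear K X).
Proof.
split; first by rewrite inE; split=> [a x y|x]; [rewrite scaler0 addr0|exact: cvg_cst].
move=> a f g; rewrite !inE => -[lf cf] [lg cg]; split => [b x y|x].
  rewrite !fctE lf lg !scalerDr !scalerA (mulrC a b) addrACA//.
apply: cvgD; last exact: cg.
by apply: cvgZl_tmp; exact: cf.
Qed.

HB.instance Definition _ := GRing.isSubmodClosed.Build _ _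
  (@cont_linear K X) cont_linear_submod_closed.
HB.instance Definition _ := [SubChoice_isSubLmodule of dual X by <:].

Lemma dual_linear (f : dual X) : linear f.
Proof. by have /set_mem[] := dualP f. Qed.

HB.instance Definition _ (f : dual X) :=
  GRing.isLinear.Build K X K^o _ (dual_val f) (dual_linear f).

Lemma dual_continuous (f : dual X) : continuous f.
Proof. by have /set_mem[] := dualP f. Qed.

End dual_lmodule.

Definition dual_norm (K : supNumFieldType) (X : normedModType K)
    (f : dual X) : K :=
  supremum 0 [set `|f x| | x in [set x | `|x| <= 1]].

Section dual_normed.
Context {K : supNumFieldType} {X : normedModType K}.
Implicit Types f g : dual X.

Let values f := [set `|f x| | x in [set x | `|x| <= 1]].

Lemma dual_norm_supremums f : supremums (values f) (dual_norm f).
Proof.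
have v0 : values f 0 by exists 0 => /=; rewrite ?linear0 normr0.
rewrite /dual_norm /supremum ifF; last first.
  by apply/negbTE/set0P; exists 0.
have [] : supremums (values f) !=set0.
- apply: nonneg_sup_ex; first by exists 0.
    by move=> _ [x _ <-]/=.
  have /linear_bounded_continuous/linear_boundedP := @dual_continuous _ _ f.
  move=> /pinfty_ex_gt0[r r0 fr]; exists r => _ [x /= x1 <-].
  by rewrite (le_trans (fr _))// ler_piMr// ltW.
by move=> s; exact: xgetI.
Qed.

Lemma le_dual_norm f x : `|f x| <= dual_norm f * `|x|.
Proof.
have [->|x0] := eqVneq x 0; first by rewrite linear0 !normr0 mulr0.
have nx0 : 0 < `|x| by rewrite normr_gt0.
rewrite -ler_pdivrMr//; apply: (dual_norm_supremums f).1.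
exists (`|x|^-1 *: x) => /=.
  by rewrite normrZ normfV normr_id mulVf// gt_eqF.
by rewrite linearZ/= normrZ normfV normr_id mulrC.
Qed.

Lemma dual_norm_le f (M : K) : (forall x, `|x| <= 1 -> `|f x| <= M) ->
  dual_norm f <= M.
Proof. by move=> fM; apply: (dual_norm_supremums f).2 => _ [x /= /fM ? <-]. Qed.

Lemma dual_norm_ge0 f : 0 <= dual_norm f.
Proof.
by apply: (dual_norm_supremums f).1; exists 0; rewrite /= ?linear0 normr0.
Qed.

Let dual_normD f g : dual_norm (f + g) <= dual_norm f + dual_norm g.
Proof.
apply: dual_norm_le => x x1; rewrite (le_trans (ler_normD _ _))//.
apply: lerD; rewrite (le_trans (le_dual_norm _ _))//.
  by rewrite ler_piMr// dual_norm_ge0.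
by rewrite ler_piMr// dual_norm_ge0.
Qed.

Let dual_normZ_le (a : K) f : dual_norm (a *: f) <= `|a| * dual_norm f.
Proof.
apply: dual_norm_le => x x1; rewrite normrZ ler_wpM2l//.
by rewrite (le_trans (le_dual_norm _ _))// ler_piMr// dual_norm_ge0.
Qed.

Let dual_norm0_eq0 f : dual_norm f = 0 -> f = 0.
Proof.
move=> f0; apply/val_inj/funext => x; apply/eqP; rewrite -normr_le0.
by rewrite (le_trans (le_dual_norm _ _))// f0 mul0r.
Qed.

Let dual_normZ (a : K) f : dual_norm (a *: f) = `|a| * dual_norm f.
Proof.
apply/eqP; rewrite eq_le dual_normZ_le/=.
have [->|a0] := eqVneq a 0; first by rewrite normr0 mul0r dual_norm_ge0.
have a_gt0 : 0 < `|a| by rewrite normr_gt0.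
rewrite -ler_pdivlMl// -{1}(scale1r f) -(mulVf a0) -scalerA.
by rewrite (le_trans (dual_normZ_le _ _))// normfV.
Qed.

HB.instance Definition _ := @Lmodule_isNormed.Build K (dual X)
  (@dual_norm K X) dual_normD dual_normZ dual_norm0_eq0.

Lemma dual_normE f : `|f| = dual_norm f. Proof. by []. Qed.

End dual_normed.

(* X endowed with sigma(X, X'), the coarsest topology making every element of
   X' continuous. *)
Definition weak (K : supNumFieldType) (X : normedModType K) : Type := X.

HB.instance Definition _ (K : supNumFieldType) (X : normedModType K) :=
  Choice.on (weak X).
HB.instance Definition _ (K : supNumFieldType) (X : normedModType K) :=
  Topological.copy (weak X)
    (sup_topology (fun f : dual X =>
       Topological.class (initial_topology (dual_val f)))).

Definition weakly_cvg (K : supNumFieldType) (X : normedModType K)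
    (x : nat -> X) (l : X) : Prop :=
  (x : nat -> weak X) @ \oo --> (l : weak X).

Lemma weakly_cvgP (K : supNumFieldType) (X : normedModType K)
    (x : nat -> X) (l : X) :
  weakly_cvg x l <-> forall f : dual X, f (x j) @[j --> \oo] --> f l.
Proof.
rewrite /weakly_cvg; split => [xl f|xl].
  have /cvg_sup/(_ f) xlf := xl.
  apply: (cvg_trans (cvg_app (dual_val f) xlf)).
  exact: (@initial_continuous _ _ (dual_val f)).
apply/cvg_sup => f.
move=> A [_ [[B oB <-] Bl] BA].
apply: filterS BA _; apply: xl; exact: open_nbhs_nbhs.
Qed.

Section bidual_embedding.
Context {K : supNumFieldType} {X : normedModType K}.

Lemma eval_cont_linear (x : X) :
  (fun f : dual X => f x) \in @cont_linear K (dual X).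
Proof.
have lin : linear (fun f : dual X => f x : K^o) by [].
apply/mem_set; split => //.
pose ev : {linear dual X -> K^o} :=
  HB.pack (fun f : dual X => f x : K^o)
    (GRing.isLinear.Build K (dual X) K^o _ _ lin).
apply: (@bounded_linear_continuous _ _ _ ev); apply/linear_boundedP.
exists `|x|; split; first exact: normr_real.
move=> r /ltW xr f /=; rewrite (le_trans (le_dual_norm f x))// mulrC.
by rewrite ler_wpM2r// dual_norm_ge0.
Qed.

Definition bidual_embedding (x : X) : dual (dual X) :=
  Dual (eval_cont_linear x).

End bidual_embedding.

Definition reflexive_space (K : supNumFieldType) (X : normedModType K) : Prop :=
  forall phi : dual (dual X), exists x : X, bidual_embedding x = phi.

Definition bounded_operator (K : supNumFieldType) (X : normedModType K)
    (T : {linear X -> X}) : Prop :=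
  bounded_near T (nbhs (0 : X)).

Definition demi_dunford_pettis (K : supNumFieldType) (X : normedModType K)
    (T : {linear X -> X}) : Prop :=
  forall x : nat -> X,
    weakly_cvg x 0 ->
    (`|x j - T (x j)| : K^o) @[j --> \oo] --> (0 : K^o) ->
    (`|x j| : K^o) @[j --> \oo] --> (0 : K^o).

Definition weakly_demi_dunford_pettis (K : supNumFieldType)
    (X : normedModType K) (T : {linear X -> X}) : Prop :=
  forall (x : nat -> X) (f : nat -> dual X),
    weakly_cvg x 0 ->
    weakly_cvg f 0 ->
    (`|x j - T (x j)| : K^o) @[j --> \oo] --> (0 : K^o) ->
    (`|f j (x j)| : K^o) @[j --> \oo] --> (0 : K^o).

(* Main.v *)
Require Import Defs.
From HB Require Import structures.
From mathcomp Require Import all_boot all_order all_algebra.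
From mathcomp Require Import complex.
From mathcomp Require Import all_classical all_reals all_analysis.
From mathcomp Require Import ring lra.

(** Suppose that (x_j) is weakly null with |x_j - T x_j| -> 0, but that
    |x_j| >= e for infinitely many j.  The Hahn-Banach theorem gives functionals
    f_j, uniformly bounded, with |f_j(x_j)| >= |x_j|.  Since X is reflexive, a
    subsequence f_(s n) converges weakly to some g.  Then f_(s n) - g is weakly
    null, so the weak demi Dunford-Pettis property yields
    (f_(s n) - g)(x_(s n)) -> 0; as also g(x_(s n)) -> 0, this contradicts
    |f_(s n)(x_(s n))| >= |x_(s n)| >= e.

    The substance is the extraction of the weakly convergent subsequence, that
    is, the case of the Eberlein-Smulian theorem that is needed here
    (ex_pointwise_cvg_selection).  By reflexivity, weak convergence in X' is
    pointwise convergence on X.  Limits along an ultrafilter U provide a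
    candidate g, and every pointwise limit of the f_j along a filter lies in
    their closed linear span S: otherwise a functional on X', which is
    evaluation at a point x, would vanish on all the f_j but not on the limit
    (pointwise_limit_closed_span).  The space S is separable, so a countable
    subset D of X separates its elements (closed_span_eq0).  A selection s is
    made so that f_(s n) -> g on D; any other pointwise cluster value of
    f_(s n) is taken by a functional that lies in S and agrees with g on D,
    hence is g itself.  So f_(s n) -> g pointwise on all of X.

    The argument is carried out over any scalar field that satisfies three
    facts (real_or_complex_like): a separation theorem, the convergence of
    bounded sequences along ultrafilters, and separability.  For the reals the
    separation theorem comes from a Hahn-Banach theorem for sublinear
    functionals, obtained from Zorn's lemma without extending partial
    functionals: a minimal sublinear functional is linear.  The complex case
    follows by viewing a complex space as a real one and complexifying the
    functional u into y |-> u(y) - i u(iy). *)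

Set Implicit Arguments.
Unset Strict Implicit.
Unset Printing Implicit Defensive.

Import Order.TTheory GRing.Theory Num.Theory.
Import numFieldNormedType.Exports.

Local Open Scope classical_set_scope.
Local Open Scope ring_scope.

(** * A Hahn-Banach theorem for sublinear functionals *)

Section sublinear.
Context {R : realType} {V : lmodType R}.
Implicit Types (p q : V -> R) (x y z : V).

(** Homogeneity is required in the form of an inequality only, because this is
    what passes directly to an infimum; equality follows (sublinZ). *)
Record sublinear q : Prop := Sublinear {
  sublinD : forall x y, q (x + y) <= q x + q y;
  sublinZ_le : forall (a : R) x, 0 <= a -> q (a *: x) <= a * q x
}.

Lemma sublin0 q : sublinear q -> q 0 = 0.
Proof.
case=> qD qZ; apply/eqP; rewrite eq_le; apply/andP; split.
  by have := qZ 0 0 (lexx 0); rewrite scale0r mul0r.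
by have := qD 0 0; rewrite addr0 -[X in X <= _]addr0 lerD2l.
Qed.

Lemma sublin_opp_ge q x : sublinear q -> - q (- x) <= q x.
Proof. by move=> sq; have := sublinD sq x (- x); rewrite subrr sublin0//; lra. Qed.

Lemma sublinZ q (a : R) x : sublinear q -> 0 <= a -> q (a *: x) = a * q x.
Proof.
move=> sq; rewrite le_eqVlt => /predU1P[<-|a0].
  by rewrite scale0r mul0r sublin0.
apply/eqP; rewrite eq_le (sublinZ_le sq _ (ltW a0))/=.
have ai0 : 0 <= a^-1 by rewrite invr_ge0 ltW.
have := sublinZ_le sq (a *: x) ai0; rewrite scalerA mulVf ?gt_eqF// scale1r.
by rewrite ler_pdivlMl.
Qed.

(** The common source of the three sublinear functionals used below: the infimum
    of a chain, the drift of a functional in a direction, and the distance to a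
    subspace. *)
Lemma inf_sublinear (I : Type) (D : set I) (F : I -> V -> R) :
  D !=set0 -> (forall x, has_lbound [set F i x | i in D]) ->
  (forall i j x y, D i -> D j ->
     exists2 k, D k & F k (x + y) <= F i x + F j y) ->
  (forall (a : R) i x, 0 <= a -> D i ->
     exists2 k, D k & F k (a *: x) <= a * F i x) ->
  sublinear (fun x => inf [set F i x | i in D]).
Proof.
move=> [i0 Di0] lb FD FZ.
have infle i x : D i -> inf [set F i x | i in D] <= F i x.
  by move=> Di; apply: ge_inf => //; exists i.
have leinf x m : (forall i, D i -> m <= F i x) -> m <= inf [set F i x | i in D].
  move=> h; apply: lb_le_inf; first by exists (F i0 x), i0.
  by move=> _ [i Di <-]; exact: h.
split => [x y|a x].
  rewrite -lerBlDr; apply/leinf => i Di; rewrite lerBlDr -lerBlDl.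
  apply/leinf => j Dj; rewrite lerBlDl.
  by have [k Dk] := FD i j x y Di Dj; apply: le_trans; exact: infle.
rewrite le_eqVlt => /predU1P[<-|a0].
  have [k Dk h] := FZ 0 i0 x (lexx 0) Di0.
  by rewrite !mul0r in h *; apply: le_trans h; exact: infle.
rewrite -ler_pdivrMl//; apply/leinf => i Di; rewrite ler_pdivrMl//.
by have [k Dk] := FZ a i x (ltW a0) Di; apply: le_trans; exact: infle.
Qed.

(** Zorn's lemma for the pointwise order: a chain has the infimum of its members
    as a lower bound, finite at x because q x >= - q (- x) >= - p (- x) for every
    sublinear q <= p. *)
Lemma ex_minimal_sublinear p : sublinear p -> exists q,
  [/\ sublinear q, forall y, q y <= p y &
      forall r, sublinear r -> (forall y, r y <= q y) -> r = q].
Proof.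
move=> sp; pose T := {q : V -> R | sublinear q /\ forall y, q y <= p y}.
pose below (s t : T) := `[< forall y, sval t y <= sval s y >].
have [|||A totA|q qmin] := @Zorn T below.
- by move=> t; apply/asboolP.
- by move=> r s t /asboolP rs /asboolP st; apply/asboolP => y; exact: le_trans (rs y).
- move=> [s sP] [t tP] /asboolP/= st /asboolP/= ts; apply: eq_exist.
  apply/funext => y; by apply/eqP; rewrite eq_le st ts.
- have [A0|/set0P[t0 At0]] := eqVneq A set0.
    by exists (exist _ p (conj sp (fun=> lexx _))) => s; rewrite A0.
  have lb x : has_lbound [set sval t x | t in A].
    exists (- p (- x)) => _ [t _ <-]; have [st tp] := svalP t.
    by rewrite (le_trans _ (sublin_opp_ge x st))// lerN2.
  have sinf : sublinear (fun x => inf [set sval t x | t in A]).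
    apply: inf_sublinear => //; first by exists t0.
      move=> s t x y As At; have [/asboolP st|/asboolP ts] := totA _ _ As At.
        exists t => //; have [tt _] := svalP t.
        by rewrite (le_trans (sublinD tt _ _))// lerD2r st.
      exists s => //; have [ss _] := svalP s.
      by rewrite (le_trans (sublinD ss _ _))// lerD2l ts.
    by move=> a t x a0 At; exists t => //; have [tt _] := svalP t; exact: sublinZ_le.
  have infp y : inf [set sval t y | t in A] <= p y.
    have [_ tp] := svalP t0; rewrite (le_trans _ (tp y))//.
    by apply: ge_inf => //; exists t0.
  exists (exist _ (fun x => inf [set sval t x | t in A]) (conj sinf infp) : T).
  move=> s As; apply/asboolP => y /=.
  by apply: ge_inf => //; exists s.
- have [sq qp] := svalP q; exists (sval q); split => // r sr rq.
  have rp y : r y <= p y by exact: le_trans (qp y).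
  have qr : below q (exist _ r (conj sr rp)) by exact/asboolP.
  exact: (f_equal (fun t : T => sval t) (qmin _ qr)).
Qed.

(** The largest sublinear functional r <= q such that r (- z) <= - q z, that is,
    such that r is forced to reach q z at z. *)
Definition drift q z y := inf [set q (y + t *: z) - t * q z | t in [set t | 0 <= t]].

Lemma drift_lbound q z y : sublinear q ->
  lbound [set q (y + t *: z) - t * q z | t in [set t | 0 <= t]] (- q (- y)).
Proof.
move=> sq _ [t /= t0 <-]; rewrite -(sublinZ z sq t0).
have := sublinD sq (y + t *: z) (- y); rewrite addrAC subrr add0r; lra.
Qed.

Lemma drift_le q z y (t : R) : sublinear q -> 0 <= t ->
  drift q z y <= q (y + t *: z) - t * q z.
Proof.
move=> sq t0; apply: ge_inf; last by exists t.
by exists (- q (- y)); exact: drift_lbound.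
Qed.

Lemma sublinear_drift q z : sublinear q -> sublinear (drift q z).
Proof.
move=> sq; apply: inf_sublinear; first by exists 0 => /=.
- by move=> y; exists (- q (- y)); exact: drift_lbound.
- move=> s t x y /= s0 t0; exists (s + t); rewrite /= ?addr_ge0//.
  rewrite scalerDl addrACA mulrDl.
  by have := sublinD sq (x + s *: z) (y + t *: z); lra.
- move=> a t x /= a0 t0; exists (a * t); rewrite /= ?mulr_ge0//.
  by rewrite -scalerA -scalerDr (sublinZ _ sq a0) mulrBr mulrA.
Qed.

(** A minimal sublinear q equals each of its drifts, hence q (- y) <= - q y for
    all y, so q is odd and therefore linear.  Starting from the drift of p in the
    direction z gives moreover - u z = u (- z) <= - p z. *)
Lemma hahn_banach_sublinear p z : sublinear p -> exists u : V -> R,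
  [/\ linear (u : V -> R^o), forall y, u y <= p y & u z = p z].
Proof.
move=> sp.
have [q [sq qp qmin]] := ex_minimal_sublinear (sublinear_drift z sp).
have le_p y : q y <= p y.
  rewrite (le_trans (qp y))// (le_trans (drift_le z y sp (lexx 0)))//.
  by rewrite scale0r addr0 mul0r subr0.
have qN y : q (- y) = - q y.
  have dq : drift q y = q.
    apply: qmin => [|x]; first exact: sublinear_drift.
    by rewrite (le_trans (drift_le y x sq (lexx 0)))// scale0r addr0 mul0r subr0.
  have := drift_le y (- y) sq (ler01 : 0 <= 1).
  rewrite dq scale1r addNr sublin0// mul1r.
  by have := sublin_opp_ge y sq => ? ?; apply/eqP; rewrite eq_le; apply/andP; split; lra.
have qD x y : q (x + y) = q x + q y.
  apply/eqP; rewrite eq_le sublinD//=.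
  by have := sublinD sq (x + y) (- y); rewrite addrK qN; lra.
have qZ (a : R) x : q (a *: x) = a * q x.
  have [a0|a0] := leP 0 a; first exact: sublinZ.
  by rewrite -[a]opprK scaleNr qN sublinZ ?oppr_ge0 ?ltW// !mulNr opprK.
exists q; split => [a x y|//|]; first by rewrite qD qZ.
apply/eqP; rewrite eq_le le_p/=.
have := qp (- z); rewrite qN => h.
have := drift_le z (- z) sp (ler01 : 0 <= 1).
by rewrite scale1r addNr sublin0// mul1r; lra.
Qed.

(** Hahn-Banach applied to the distance to S, a seminorm that is dominated by N,
    vanishes on S and is at least e at z. *)
Lemma ex_linear_separating (N : V -> R) (S : set V) z (e : R) :
  (forall x y, N (x + y) <= N x + N y) ->
  (forall (a : R) x, N (a *: x) = `|a| * N x) ->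
  S 0 -> (forall x y, S x -> S y -> S (x + y)) ->
  (forall (a : R) x, S x -> S (a *: x)) ->
  (forall s, S s -> e <= N (z - s)) ->
  exists u : V -> R, [/\ linear (u : V -> R^o), forall y, `|u y| <= N y,
    forall s, S s -> u s = 0 & e <= u z].
Proof.
move=> ND NZ S0 SD SZ ez.
have NN y : N (- y) = N y by rewrite -scaleN1r NZ normrN1 mul1r.
have N0 y : 0 <= N y.
  by have := ND y (- y); rewrite subrr -(scale0r 0) NZ normr0 mul0r NN; lra.
pose p y := inf [set N (y - s) | s in S].
have lb y : has_lbound [set N (y - s) | s in S] by exists 0 => _ [s _ <-].
have p_le y s : S s -> p y <= N (y - s) by move=> Ss; apply: ge_inf => //; exists s.
have sp : sublinear p.
  apply: inf_sublinear => //; first by exists 0.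
    move=> s t x y Ss St; exists (s + t); first exact: SD.
    by rewrite opprD addrACA.
  move=> a s x a0 Ss; exists (a *: s); first exact: SZ.
  by rewrite -scalerBr NZ ger0_norm.
have [u [lu up uz]] := hahn_banach_sublinear z sp.
pose U : {linear V -> R^o} := HB.pack u (GRing.isLinear.Build R V R^o _ u lu).
have uN y : u (- y) = - u y := raddfN U y.
have abs y c : p y <= c -> p (- y) <= c -> `|u y| <= c.
  move=> py pNy; rewrite ler_norml; apply/andP; split.
    by rewrite lerNl -uN (le_trans (up _)).
  by rewrite (le_trans (up _)).
exists u; split => //.
- by move=> y; apply/abs; rewrite (le_trans (p_le _ _ S0))// subr0 ?NN.
- move=> s Ss; apply/normr0_eq0/eqP; rewrite eq_le normr_ge0 andbT.
  have z0 : N 0 = 0 by rewrite -(scale0r 0) NZ normr0 mul0r.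
  apply/abs; first by rewrite (le_trans (p_le _ _ Ss))// subrr z0.
  by rewrite (le_trans (p_le _ _ (SZ (-1) _ Ss)))// scaleN1r subrr z0.
- rewrite uz; apply: lb_le_inf; first by exists (N (z - 0)), 0.
  by move=> _ [s Ss <-]; exact: ez.
Qed.

End sublinear.

(** * Scalars and functionals *)

Lemma ex_dual_bounded (K : supNumFieldType) (X : normedModType K)
    (g : X -> K^o) (M : K) : linear g -> 0 <= M ->
  (forall x, `|g x| <= M * `|x|) -> exists f : dual X, forall x, f x = g x.
Proof.
move=> lin M0 gM.
have gP : g \in @cont_linear K X.
  apply/mem_set; split => //.
  pose G : {linear X -> K^o} := HB.pack g (GRing.isLinear.Build K X K^o _ g lin).
  apply: (@bounded_linear_continuous _ _ _ G); apply/linear_boundedP.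
  exists M; split; first exact: ger0_real.
  by move=> r /ltW Mr x /=; rewrite (le_trans (gM x))// ler_wpM2r.
by exists (Dual gP).
Qed.

(** The supremum axiom makes K archimedean: if all the integers were below 1/e,
    their supremum s would satisfy s <= s - 1. *)
Lemma near_invS_lt (K : supNumFieldType) (e : K) : 0 < e ->
  exists N, forall n, (N <= n)%N -> n.+1%:R^-1 < e.
Proof.
move=> e0; apply: contrapT => nN.
have ub n : n%:R <= e^-1.
  apply: contrapT => /negP; rewrite -real_ltNge ?realn ?gtr0_real ?invr_gt0// => ne.
  apply: nN; exists n => m nm; rewrite invf_plt ?posrE ?ltr0n//.
  by rewrite (lt_le_trans ne)// ler_nat ltnW.
have [s [s_ub s_min]] : supremums [set (n%:R : K) | n in [set: nat]] !=set0.
  apply: nonneg_sup_ex; first by exists 0, 0%N.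
    by move=> _ [n _ <-] /=; rewrite ler0n.
  by exists e^-1 => _ [n _ <-].
have : s <= s - 1.
  apply: s_min => _ [n _ <-]; rewrite lerBrDr natr1.
  by apply: s_ub; exists n.+1.
by rewrite lerDl oppr_ge0 ler10.
Qed.

Lemma scalar_cvg_unique (K : numFieldType) (T : Type) (F : set_system T)
    {FF : ProperFilter F} (a : T -> K) (l l' : K) :
  (a n : K^o) @[n --> F] --> (l : K^o) ->
  (a n : K^o) @[n --> F] --> (l' : K^o) -> l = l'.
Proof. by move=> al al'; exact: (cvg_unique (@norm_hausdorff _ K^o) al al'). Qed.

Lemma dual_subE (K : supNumFieldType) (X : normedModType K) (f g : dual X) x :
  (f - g) x = f x - g x.
Proof. by []. Qed.

(** What the proof needs to know about the scalars.  In the separation property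
    the constant 2, rather than the optimal 1, is harmless and spares the
    rotation argument in the complex case. *)
Record real_or_complex_like (K : supNumFieldType) : Prop := {
  annihilator_separation : forall (Z : normedModType K) (S : set Z) (z : Z) (e : K),
    S 0 -> (forall x y, S x -> S y -> S (x + y)) ->
    (forall (a : K) x, S x -> S (a *: x)) ->
    (forall s, S s -> e <= `|z - s|) ->
    exists f : dual Z, [/\ forall y, `|f y| <= 2 * `|y|,
      forall s, S s -> f s = 0 & e <= `|f z|];
  bounded_ultra_cvg : forall (a : nat -> K) (M : K) (U : set_system nat),
    UltraFilter U -> (forall n, `|a n| <= M) ->
    exists l : K, (a n : K^o) @[n --> U] --> (l : K^o);
  scalar_separable : exists q : nat -> K, forall (a e : K), 0 < e ->
    exists n, `|a - q n| < e
}.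

(** * The closed linear span of a sequence *)

Section closed_span.
Context {K : numFieldType} {Z : normedModType K}.
Variables (q : nat -> K) (f : nat -> Z).
Hypothesis q_dense : forall (a e : K), 0 < e -> exists n, `|a - q n| < e.

(** The linear combinations of the f i with coefficients among the q k; encoding
    them by lists of pairs makes them countable, and turns sums into
    concatenations. *)
Fixpoint comb (c : seq (nat * nat)) : Z :=
  if c is (i, k) :: c' then q k *: f i + comb c' else 0.

Definition closed_span : set Z :=
  [set z | forall e : K, 0 < e -> exists c, `|z - comb c| < e].

Lemma comb_cat c d : comb (c ++ d) = comb c + comb d.
Proof. by elim: c => [|[i k] c IH] /=; rewrite ?add0r// IH addrA. Qed.

Lemma closed_span0 : closed_span 0.
Proof. by move=> e e0; exists [::]; rewrite subrr normr0. Qed.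

Lemma closed_spanD x y : closed_span x -> closed_span y -> closed_span (x + y).
Proof.
move=> Sx Sy e e0; have e2 : 0 < e / 2 by rewrite divr_gt0.
have [[c hc] [d hd]] := (Sx _ e2, Sy _ e2); exists (c ++ d).
rewrite comb_cat opprD addrACA (splitr e).
by rewrite (le_lt_trans (ler_normD _ _))// ltrD.
Qed.

Lemma closed_span_closed z :
  (forall e : K, 0 < e -> exists2 s, closed_span s & `|z - s| < e) ->
  closed_span z.
Proof.
move=> Sz e e0; have e2 : 0 < e / 2 by rewrite divr_gt0.
have [s Ss zs] := Sz _ e2; have [c sc] := Ss _ e2; exists c.
rewrite -(subrK s z) -addrA (splitr e).
by rewrite (le_lt_trans (ler_normD _ _))// ltrD.
Qed.

Lemma closed_span_gen (a : K) i : closed_span (a *: f i).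
Proof.
move=> e e0; have n0 : 0 < `|f i| + 1 by rewrite ltr_wpDl.
have [k hk] := q_dense a (divr_gt0 e0 n0); exists [:: (i, k)] => /=.
rewrite addr0 -scalerBl normrZ.
rewrite (le_lt_trans (_ : _ <= `|a - q k| * (`|f i| + 1)))//.
  by rewrite ler_wpM2l// lerDl.
by rewrite -ltr_pdivlMr.
Qed.

Lemma closed_spanZ (a : K) x : closed_span x -> closed_span (a *: x).
Proof.
have Scomb c : closed_span (a *: comb c).
  elim: c => [|[i k] c IH] /=; first by rewrite scaler0; exact: closed_span0.
  by rewrite scalerDr scalerA; apply: closed_spanD => //; exact: closed_span_gen.
move=> Sx; apply: closed_span_closed => e e0.
have n0 : 0 < `|a| + 1 by rewrite ltr_wpDl.
have [c hc] := Sx _ (divr_gt0 e0 n0); exists (a *: comb c) => //.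
rewrite -scalerBr normrZ.
rewrite (le_lt_trans (_ : _ <= (`|a| + 1) * `|x - comb c|))//.
  by rewrite ler_wpM2r// lerDl.
by rewrite mulrC -ltr_pdivlMr.
Qed.

Lemma closed_spanB x y : closed_span x -> closed_span y -> closed_span (x - y).
Proof. by move=> Sx /(closed_spanZ (-1)); rewrite scaleN1r; exact: closed_spanD. Qed.

Lemma notin_closed_span z : ~ closed_span z ->
  exists2 e : K, 0 < e & forall s, closed_span s -> e <= `|z - s|.
Proof.
move=> nSz; apply: contrapT => ne; apply: nSz; apply: closed_span_closed => e e0.
apply: contrapT => nes; apply: ne; exists e => // s Ss.
rewrite real_leNgt ?normr_real ?gtr0_real//; apply/negP => zs.
by apply: nes; exists s.
Qed.

End closed_span.

(** * Weak sequential compactness in the dual of a reflexive space *)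

Section reflexive_subsequence.
Context {K : supNumFieldType} {X : normedModType K}.
Hypothesis KP : real_or_complex_like K.

(** The sequential form of the Banach-Alaoglu theorem along an ultrafilter. *)
Lemma bounded_dual_ultra_cvg (f : nat -> dual X) (M : K) (U : set_system nat) :
  UltraFilter U -> 0 <= M -> (forall n x, `|f n x| <= M * `|x|) ->
  exists g : dual X, forall x, (f n x : K^o) @[n --> U] --> (g x : K^o).
Proof.
move=> UU M0 fM.
have /choice[g gP] : forall x, exists l : K, (f n x : K^o) @[n --> U] --> (l : K^o).
  by move=> x; exact: (bounded_ultra_cvg KP UU (fun n => fM n x)).
have lin : linear (g : X -> K^o).
  move=> a x y; apply: (scalar_cvg_unique (gP (a *: x + y))).
  under eq_cvg do rewrite linearP.
  exact: cvgD (cvgZl_tmp (V:=K^o) (k:=a) (gP x)) (gP y).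
have gM x : `|g x| <= M * `|x|.
  apply/ler_addgt0Pr => e e0.
  have /cvgrPdist_lt/(_ e e0)/filter_ex[n hn] := gP x.
  rewrite -(subrK (f n x) (g x)) (le_trans (ler_normD _ _))// addrC lerD//.
  exact: ltW.
have [h hP] := ex_dual_bounded lin M0 gM.
by exists h => x; rewrite hP; exact: gP.
Qed.

(** The factor 2 leaves room below a supremum that need not be attained. *)
Lemma ex_norming_point (h : dual X) :
  exists2 x : X, `|x| <= 1 & `|h| <= 2 * `|h x|.
Proof.
apply: contrapT => nx.
have : `|h| <= `|h| / 2.
  rewrite {1}dual_normE; apply: dual_norm_le => x x1.
  rewrite ler_pdivlMr// mulrC real_leNgt ?normr_real ?ger0_real ?mulr_ge0//.
  by apply/negP => /ltW hx; apply: nx; exists x.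
rewrite ler_pdivlMr// mulr_natr mulr2n gerDl => h0; apply: nx; exists 0.
  by rewrite normr0.
by rewrite (le_trans h0)// mulr_ge0.
Qed.

Hypothesis reflX : reflexive_space X.
Variable q : nat -> K.
Hypothesis q_dense : forall (a e : K), 0 < e -> exists n, `|a - q n| < e.

(** Otherwise some phi in X'' vanishes on the span but not at g; as phi is the
    evaluation at some x, all the k n x vanish, and so does their limit g x. *)
Lemma pointwise_limit_closed_span (f k : nat -> dual X) (g : dual X)
    (F : set_system nat) : ProperFilter F ->
  (forall n, closed_span q f (k n)) ->
  (forall x, (k n x : K^o) @[n --> F] --> (g x : K^o)) -> closed_span q f g.
Proof.
move=> FF kS kg; apply: contrapT => /notin_closed_span[e e0 eg].
have [phi [_ phiS phig]] := annihilator_separation KP (closed_span0 q f)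
  (@closed_spanD _ _ q f) (closed_spanZ q_dense) eg.
have [x phiE] := reflX phi; rewrite -phiE /= in phiS phig.
have gx : g x = 0.
  apply: (scalar_cvg_unique (kg x)).
  under eq_cvg => n do rewrite (phiS _ (kS n)).
  exact: cvg_cst.
by have := lt_le_trans e0 phig; rewrite gx normr0 ltxx.
Qed.

(** The points d c, each norming one of the countably many combinations up to a
    factor 2, separate the elements of the closed span: if h vanishes at them
    and c is a combination with |h - c| < e / 3, then
    |c| <= 2 |c (d c)| = 2 |(h - c) (d c)| <= 2 e / 3, so |h| <= e. *)
Lemma closed_span_eq0 (f : nat -> dual X) (d : seq (nat * nat) -> X) (h : dual X) :
  (forall c, `|d c| <= 1) -> (forall c, `|comb q f c| <= 2 * `|comb q f c (d c)|) ->
  closed_span q f h -> (forall c, h (d c) = 0) -> h = 0.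
Proof.
move=> d1 dn Sh hd; apply/eqP; rewrite -normr_le0; apply/ler_addgt0Pr => e e0.
have [c hc] := Sh (e / 3) (divr_gt0 e0 (ltr0Sn _ 2)).
have cE : `|comb q f c| <= 2 * (e / 3).
  rewrite (le_trans (dn c))// ler_wpM2l//.
  have -> : comb q f c (d c) = - ((h - comb q f c) (d c)).
    by rewrite dual_subE hd sub0r opprK.
  rewrite normrN (le_trans (le_dual_norm _ _))// -dual_normE.
  by rewrite (le_trans _ (ltW hc))// ler_piMr.
rewrite -(subrK (comb q f c) h) (le_trans (ler_normD _ _))//.
rewrite (le_trans (lerD (ltW hc) cE))// add0r.
by have -> : e / 3 + 2 * (e / 3) = e by field.
Qed.

(** Weak sequential compactness of bounded sets in the dual of a reflexive space;
    the set A allows a further condition on the selected indices. *)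
Lemma ex_pointwise_cvg_selection (f : nat -> dual X) (M : K)
    (U : set_system nat) (A : set nat) :
  UltraFilter U -> \oo `<=` U -> U A -> 0 <= M ->
  (forall n x, `|f n x| <= M * `|x|) ->
  exists (s : nat -> nat) (g : dual X), [/\ forall n, (n <= s n)%N,
    forall n, A (s n) &
    forall x, (f (s n) x : K^o) @[n --> \oo] --> (g x : K^o)].
Proof.
move=> UU ooU UA M0 fM.
have [g gP] := bounded_dual_ultra_cvg UU M0 fM.
have /choice[d dP] : forall c, exists x : X,
    `|x| <= 1 /\ `|comb q f c| <= 2 * `|comb q f c x|.
  by move=> c; have [x] := ex_norming_point (comb q f c); exists x.
have e0 n : 0 < n.+1%:R^-1 :> K by rewrite invr_gt0 ltr0n.
pose close n j := forall c, (pickle c <= n)%N -> `|g (d c) - f j (d c)| < n.+1%:R^-1.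
have Uclose n : U (close n).
  pose near_d m := [set j | forall c, (pickle c < m)%N ->
    `|g (d c) - f j (d c)| < n.+1%:R^-1].
  suff Um m : U (near_d m) by have := Um n.+1; apply: filterS => j + c; exact.
  elim: m => [|m IH]; first by apply: filterS filterT => j _ c; rewrite ltn0.
  have Um : U [set j | forall c, pickle c = m ->
      `|g (d c) - f j (d c)| < n.+1%:R^-1].
    have [[c cm]|nc] := pselect (exists c : seq (nat * nat), pickle c = m).
      have /cvgrPdist_lt/(_ _ (e0 n)) := gP (d c).
      apply: filterS => j hj c' c'm.
      by have /(pcan_inj pickleK) -> : pickle c' = pickle c by rewrite cm.
    by apply: filterS filterT => j _ c cm; case: nc; exists c.
  apply: filterS (filterI IH Um) => j [h1 h2] c.
  by rewrite ltnS leq_eqVlt => /predU1P[/h2//|/h1].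
(* A diagonal choice: the requirement on s n bears on finitely many points of D,
   but every point of D is eventually included, with tolerance 1 / (n + 1). *)
have /choice[s sP] : forall n, exists j, [/\ (n <= j)%N, A j & close n j].
  move=> n; have Un : U [set j | (n <= j)%N] by apply: ooU; exists n.
  by have [j [[? ?] ?]] := filter_ex (filterI (filterI Un UA) (Uclose n)); exists j.
exists s, g; split => [n|n|x]; [by case: (sP n)|by case: (sP n)|].
have fS n : closed_span q f (f n) by rewrite -[f n]scale1r; exact: closed_span_gen.
have gS : closed_span q f g by exact: pointwise_limit_closed_span gP.
have sd c : (f (s n) (d c) : K^o) @[n --> \oo] --> (g (d c) : K^o).
  apply/cvgrPdist_lt => e ep.
  have [N Ne] := near_invS_lt ep; exists (maxn N (pickle c)) => // n /=.
  rewrite geq_max => /andP[Nn cn]; have [_ _ /(_ c cn)] := sP n.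
  by move=> h; exact: lt_trans h (Ne _ Nn).
apply: contrapT => /cvgrPdist_lt nx.
have [e ep ne] : exists2 e : K, 0 < e &
    ~ (\forall n \near \oo, `|g x - f (s n) x| < e).
  by apply: contrapT => h; apply: nx => e ep; apply: contrapT => h'; apply: h; exists e.
(* If f (s n) x does not tend to g x, an ultrafilter concentrated on the indices
   where they are e-apart yields another limit functional k; it must be g. *)
pose B := [set n | ~ `|g x - f (s n) x| < e].
have FB : ProperFilter (within B \oo).
  apply: Build_ProperFilter_ex => C; rewrite /within/= => BC.
  apply: contrapT => nC; apply: ne; apply: filterS BC => n nBC.
  by apply: contrapT => Bn; apply: nC; exists n; exact: nBC.
have [V [VU BV]] := ultraFilterLemma FB.
have ooV : \oo `<=` V by move=> C ooC; apply: BV; apply: filterS ooC => n Cn _.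
have VB : V B by apply: BV; exact: withinT.
have [k kP] := bounded_dual_ultra_cvg VU M0 (fun n => fM (s n)).
have kS : closed_span q f k by apply: pointwise_limit_closed_span kP => n; exact: fS.
have gk0 : g - k = 0.
  apply: (closed_span_eq0 (d := d)).
  - by move=> c; have [] := dP c.
  - by move=> c; have [_] := dP c; exact.
  - exact: closed_spanB gS kS.
  - move=> c; apply/eqP; rewrite dual_subE subr_eq0; apply/eqP.
    apply: (scalar_cvg_unique _ (kP (d c))).
    by move=> C gC; apply: ooV; exact: (sd c C gC).
have /cvgrPdist_lt/(_ _ ep) := kP x.
rewrite -(subr0_eq gk0) => Vx.
by have [n [Bn]] := filter_ex (filterI VB Vx).
Qed.

End reflexive_subsequence.

(** * The implication over abstract scalars *)

Lemma weakly_ddp_ddp (K : supNumFieldType) (X : normedModType K)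
    (T : {linear X -> X}) : real_or_complex_like K -> reflexive_space X ->
  weakly_demi_dunford_pettis T -> demi_dunford_pettis T.
Proof.
move=> KP reflX wT x xw xT; apply: contrapT => /cvgrPdist_lt nx.
have [e e0 ne] : exists2 e : K, 0 < e & ~ (\forall n \near \oo, `|0 - `|x n| | < e).
  by apply: contrapT => h; apply: nx => e e0; apply: contrapT => h'; apply: h; exists e.
pose B := [set n | e <= `|x n|].
have FB : ProperFilter (within B \oo).
  apply: Build_ProperFilter_ex => C; rewrite /within/= => BC.
  apply: contrapT => nC; apply: ne; apply: filterS BC => n nBC.
  rewrite sub0r normrN normr_id real_ltNge ?normr_real ?gtr0_real//.
  by apply/negP => Bn; apply: nC; exists n; exact: nBC.
have [U [UU BU]] := ultraFilterLemma FB.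
have ooU : \oo `<=` U by move=> C ooC; apply: BU; apply: filterS ooC => n Cn _.
have UB : U B by apply: BU; exact: withinT.
(* Separation of x n from the zero subspace, at distance |x n|. *)
have /choice[f fP] : forall n, exists f : dual X,
    (forall y, `|f y| <= 2 * `|y|) /\ `|x n| <= `|f (x n)|.
  move=> n; have [|||f [f2 _ fx]] :=
    @annihilator_separation K KP X [set 0] (x n) `|x n| erefl.
  - by move=> _ _ -> ->; rewrite /= addr0.
  - by move=> a _ ->; rewrite /= scaler0.
  - by move=> _ ->; rewrite subr0.
  by exists f.
have [q q_dense] := scalar_separable KP.
have [s [g [s_ge sB fg]]] := ex_pointwise_cvg_selection KP reflX q_dense UU ooU UB
  (ler0n K 2) (fun n => (fP n).1).
have soo : s n @[n --> \oo] --> \oo.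
  move=> C [N _ NC]; exists N => // n /= Nn; apply: NC => /=.
  exact: leq_trans Nn (s_ge n).
have xsw : weakly_cvg (x \o s) 0.
  apply/weakly_cvgP => h; have /weakly_cvgP/(_ h) hx := xw.
  exact: (cvg_comp _ _ soo hx).
have fgw : weakly_cvg (fun n => f (s n) - g) 0.
  apply/weakly_cvgP => phi; have [y <-] := reflX phi.
  have := cvgB (fg y) (cvg_cst (g y : K^o)); rewrite subrr.
  exact.
have xsT : (`|(x \o s) n - T ((x \o s) n)| : K^o) @[n --> \oo] --> (0 : K^o).
  exact: (cvg_comp _ _ soo xT).
have e2 : 0 < e / 2 by rewrite divr_gt0.
have /cvgrPdist_lt/(_ _ e2) h1 := wT _ _ xsw fgw xsT.
have /weakly_cvgP/(_ g) := xsw; rewrite linear0 => /cvgrPdist_lt/(_ _ e2) h2.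
have [n [/= h1n h2n]] := filter_ex (filterI h1 h2).
move: h1n h2n; rewrite !sub0r !normrN normr_id => h1n h2n.
have : e < e.
  rewrite {2}(splitr e) (le_lt_trans _ (ltrD h1n h2n))//.
  rewrite (le_trans (sB n))// (le_trans (fP (s n)).2)//.
  by rewrite -{1}(subrK (g (x (s n))) (f (s n) (x (s n)))) ler_normD.
by rewrite ltxx.
Qed.

(** * Real scalars *)

Section real_scalars.
Variable R : realType.

Lemma real_ultra_cvg (a : nat -> R) (M : R) (U : set_system nat) :
  UltraFilter U -> (forall n, `|a n| <= M) ->
  exists l : R, a n @[n --> U] --> l.
Proof.
move=> UU aM.
have [l [_ cl]] : `[- M, M]%classic `&` cluster (a n @[n --> U]) !=set0.
  apply: (@segment_compact R).
  apply: (@filterS _ U _ setT) (@filterT _ U _) => n _ /=.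
  by rewrite in_itv/= -ler_norml.
exists l => C Cl; have [//|UnC] := in_ultra_setVsetC (a @^-1` C) UU.
by have [y []] := cl (~` C) C UnC Cl.
Qed.

Definition rat_seq (n : nat) : R := ratr (odflt 0 (unpickle n)).

Lemma rat_seq_dense (a e : R) : 0 < e -> exists n, `|a - rat_seq n| < e.
Proof.
move=> e0; have : a - e < a + e by lra.
move=> /rat_in_itvoo[r]; rewrite in_itv/= => /andP[ra ar].
exists (pickle r); rewrite /rat_seq pickleK/= distrC ltr_distl; exact/andP.
Qed.

Lemma realType_real_or_complex_like : real_or_complex_like R.
Proof.
split.
- move=> Z S z e S0 SD SZ ez.
  have [u [lu uN uS uz]] := ex_linear_separating (@ler_normD R Z)
    (@normrZ R Z) S0 SD SZ ez.
  have u2 y : `|u y| <= 2 * `|y|.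
    by rewrite (le_trans (uN y))// ler_peMl// ler1n.
  have [f fE] := ex_dual_bounded (X := Z) lu (ler0n R 2) u2.
  exists f; split => [y|s Ss|]; rewrite fE//; first exact: uS.
  exact: le_trans (ler_norm _).
- exact: real_ultra_cvg.
- by exists rat_seq; exact: rat_seq_dense.
Qed.

End real_scalars.

(** * Complex scalars *)

(** A complex space with its scalars restricted to the reals; an alias is needed
    to carry the second module structure. *)
Definition realified (R : realType) (Z : lmodType R[i]) : Type := Z.

Section realified.
Local Open Scope complex_scope.
Context {R : realType} {Z : lmodType R[i]}.

HB.instance Definition _ := GRing.Zmodule.on (realified Z).

Let rscale (a : R) (z : realified Z) : realified Z := (a%:C *: (z : Z))%R.

Let rscaleA a b z : rscale a (rscale b z) = rscale (a * b) z.
Proof. by rewrite /rscale scalerA rmorphM. Qed.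

Let rscale1 : left_id 1 rscale.
Proof. by move=> z; rewrite /rscale rmorph1 scale1r. Qed.

Let rscaleDr : right_distributive rscale +%R.
Proof. by move=> a x y; rewrite /rscale scalerDr. Qed.

Let rscaleDl z : {morph rscale^~ z: a b / a + b}.
Proof. by move=> a b; rewrite /rscale rmorphD scalerDl. Qed.

HB.instance Definition _ := GRing.Zmodule_isLmodule.Build R (realified Z)
  rscaleA rscale1 rscaleDr rscaleDl.

End realified.

Section complex_scalars.
Local Open Scope complex_scope.
Variable R : realType.
Implicit Types z : R[i].

Lemma norm_real_complex (a : R) : `|a%:C| = `|a|%:C.
Proof. by rewrite normc_def /= expr0n/= addr0 sqrtr_sqr. Qed.

Lemma normc_ge_Im z : `|complex.Im z|%:C <= `|z|.
Proof. by rewrite normc_def lecR -sqrtr_sqr ler_wsqrtr// lerDr sqr_ge0. Qed.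

Lemma norm_i : `|'i| = 1 :> R[i].
Proof. by rewrite normc_def /= expr0n expr1n add0r sqrtr1. Qed.

Lemma pos_complexE z : 0 < z -> exists2 r : R, 0 < r & z = r%:C.
Proof.
move=> z0; exists (complex.Re z); last by rewrite RRe_real// gtr0_real.
by move: z0; rewrite ltcE => /andP[].
Qed.

Lemma normc_le_ReIm z : `|z| <= (`|complex.Re z| + `|complex.Im z|)%:C.
Proof.
rewrite {1}(complexE z) (le_trans (ler_normD _ _))// normrM norm_i.
by rewrite mul1r !norm_real_complex rmorphD.
Qed.

Lemma complex_ultra_cvg (a : nat -> R[i]) (M : R[i]) (U : set_system nat) :
  UltraFilter U -> (forall n, `|a n| <= M) ->
  exists l : R[i], (a n : R[i]^o) @[n --> U] --> (l : R[i]^o).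
Proof.
move=> UU aM.
have [n|p ap] := @real_ultra_cvg R (fun n => complex.Re (a n)) (complex.Re M) U UU.
  have := le_trans (normc_ge_Re (a n)) (aM n).
  by rewrite lecE => /andP[].
have [n|r ar] := @real_ultra_cvg R (fun n => complex.Im (a n)) (complex.Re M) U UU.
  have := le_trans (normc_ge_Im (a n)) (aM n).
  by rewrite lecE => /andP[].
exists (p +i* r); apply/cvgrPdist_lt => _ /pos_complexE[e e0 ->].
have e2 : 0 < e / 2 by rewrite divr_gt0.
move/cvgrPdist_lt/(_ _ e2) : ap => ap; move/cvgrPdist_lt/(_ _ e2) : ar => ar.
apply: filterS2 ap ar => n /= hp hr.
rewrite (le_lt_trans (normc_le_ReIm _))// ltcR.
by rewrite [X in _ < X]splitr; case: (a n) hp hr => x y /=; exact: ltrD.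
Qed.

Definition gaussian_rat_seq (n : nat) : R[i] :=
  let: (j, k) := odflt (0, 0)%N (unpickle n) in rat_seq R j +i* rat_seq R k.

Lemma gaussian_rat_seq_dense (a e : R[i]) : 0 < e ->
  exists n, `|a - gaussian_rat_seq n| < e.
Proof.
move=> /pos_complexE[r r0 ->].
have e2 : 0 < r / 2 by rewrite divr_gt0.
have [[j hj] [k hk]] :=
  (rat_seq_dense (complex.Re a) e2, rat_seq_dense (complex.Im a) e2).
exists (pickle (j, k)); rewrite /gaussian_rat_seq pickleK /=.
rewrite (le_lt_trans (normc_le_ReIm _))// ltcR [X in _ < X]splitr.
by case: a hj hk => x y /=; exact: ltrD.
Qed.

(** The real part u of the functional is given by the real case, and
    phi y = u y - i u (i y) is the only complex-linear functional with that real
    part.  Both |u y| and |u (i y)| are at most |y|, whence the factor 2. *)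
Lemma complex_annihilator_separation (Z : normedModType R[i]) (S : set Z)
    (z : Z) (e : R[i]) :
  S 0 -> (forall x y, S x -> S y -> S (x + y)) ->
  (forall (a : R[i]) x, S x -> S (a *: x)) ->
  (forall s, S s -> e <= `|z - s|) ->
  exists f : dual Z, [/\ forall y, `|f y| <= 2 * `|y|,
    forall s, S s -> f s = 0 & e <= `|f z|].
Proof.
move=> S0 SD SZ ez.
pose N (y : realified Z) : R := complex.Re `|y : Z|.
have NE (y : Z) : `|y| = (N y)%:C by rewrite /N RRe_real// normr_real.
have ND (x y : realified Z) : N (x + y) <= N x + N y.
  by have := ler_normD (x : Z) y; rewrite !NE -rmorphD lecR.
have NZ (a : R) (x : realified Z) : N (a *: x) = `|a| * N x.
  have := normrZ a%:C (x : Z); rewrite !NE norm_real_complex -rmorphM.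
  by move/complexI.
have eE : e = (complex.Re e)%:C.
  have := ez _ S0; rewrite NE lecE => /andP[/eqP/= + _].
  by case: (e) => x y /= <-.
have ezN (s : realified Z) : S s -> complex.Re e <= N (z - s).
  by move=> /ez; rewrite eE NE lecR.
have [u [lu uN uS uz]] := ex_linear_separating (V := realified Z) ND NZ S0 SD
  (fun a x => SZ a%:C x) ezN.
pose phi (y : Z) : R[i] := u y +i* (- u ('i *: y)).
pose L : {linear realified Z -> R^o} :=
  HB.pack u (GRing.isLinear.Build R (realified Z) R^o _ u lu).
have uD (x y : Z) : u (x + y) = u x + u y by exact: (raddfD L).
have uZ (a : R) (x : Z) : u (a%:C *: x) = a * u x.
  by exact: (linearZZ L a (x : realified Z)).
have lphi : linear (phi : Z -> R[i]^o).
  have phiD x y : phi (x + y) = phi x + phi y.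
    by rewrite /phi scalerDr !uD opprD.
  move=> a x y; rewrite phiD; congr (_ + _).
  case: a => p r.
  have aE : p +i* r = p%:C + r%:C * 'i.
    by apply/eqP; rewrite eq_complex /= !(mulr0, mul0r, mulr1, addr0, add0r, subr0) !eqxx.
  have iaE : 'i * (p +i* r) = p%:C * 'i + (- r)%:C.
    by apply/eqP; rewrite eq_complex /=; apply/andP; split; apply/eqP; ring.
  rewrite /phi scalerA iaE {1}aE !scalerDl -!scalerA !uD !uZ.
  by apply/eqP; rewrite eq_complex /=; apply/andP; split; apply/eqP; ring.
have phi2 y : `|phi y| <= 2 * `|y|.
  rewrite (le_trans (normc_le_ReIm _))// NE.
  have -> : 2 * (N y)%:C = (N y + N y)%:C by rewrite rmorphD/= mulr_natl mulr2n.
  rewrite lecR /phi/= normrN lerD//.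
  suff -> : N y = N ('i *: y : Z) by exact: uN.
  by rewrite /N normrZ norm_i mul1r.
have [f fE] := ex_dual_bounded (X := Z) lphi (ler0n _ 2) phi2.
exists f; split => [y|s Ss|]; rewrite fE//.
  by rewrite /phi (uS _ Ss) (uS _ (SZ 'i _ Ss)) oppr0.
rewrite eE (le_trans _ (normc_ge_Re _))// lecR /phi /=.
exact: le_trans (ler_norm _).
Qed.

Lemma complex_real_or_complex_like : real_or_complex_like R[i].
Proof.
split.
- exact: complex_annihilator_separation.
- exact: complex_ultra_cvg.
- by exists gaussian_rat_seq; exact: gaussian_rat_seq_dense.
Qed.

End complex_scalars.

Theorem proposition2p10 (R : realType) :
  (forall (X : completeNormedModType R) (T : {linear X -> X}),
     reflexive_space X -> bounded_operator T ->
     weakly_demi_dunford_pettis T -> demi_dunford_pettis T) /\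
  (forall (X : completeNormedModType R[i]) (T : {linear X -> X}),
     reflexive_space X -> bounded_operator T ->
     weakly_demi_dunford_pettis T -> demi_dunford_pettis T).
Proof.
split=> X T reflX _ wT.
  exact: (weakly_ddp_ddp (realType_real_or_complex_like R) reflX wT).
exact: (weakly_ddp_ddp (complex_real_or_complex_like R) reflX wT).
Qed.
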